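(* Let $\mathbf{M}$ be any $u\times v$ real non-negative matrix with no zero rows and no zero columns. Then the Sinkhorn iteration of $\mathbf{M}$ converges to a pair of stable matrices; that is, the limits $\mathbf{L}=\lim_{k\to\infty}\mathbf{L}^k$ and $\mathbf{T}=\lim_{k\to\infty}\mathbf{T}^k$ exist and $(\mathbf{L},\mathbf{T})$ is a stable pair.
   Context: Row (column) normalization of a non-negative matrix with no zero rows and no zero columns means dividing every row (column) by its sum. Sinkhorn (SK) iteration of $\mathbf{M}$ generates the sequence $\mathbf{L}^1,\mathbf{T}^1,\mathbf{L}^2,\mathbf{T}^2,\dots$, where $\mathbf{L}^1$ is the row normalization of $\mathbf{M}$, $\mathbf{T}^k$ is the column normalization of $\mathbf{L}^k$, and $\mathbf{L}^{k+1}$ is the row normalization of $\mathbf{T}^k$. A pair of $u\times v$ non-negative matrices $(P,Q)$ with no zero rows and no zero columns is called stable if the column normalization of $P$ equals $Q$ and the row normalization of $Q$ equals $P$. *)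

(* Defs.v *)
From HB Require Import structures.
From mathcomp Require Import all_boot all_order all_algebra.
From mathcomp Require Import all_classical all_reals all_analysis.

Set Implicit Arguments.
Unset Strict Implicit.
Unset Printing Implicit Defensive.

Import Order.TTheory GRing.Theory Num.Theory.
Import numFieldNormedType.Exports.

Local Open Scope ring_scope.

Definition nonneg_mx (R : realType) (u v : nat) (A : 'M[R]_(u, v)) : Prop :=
  forall i j, 0 <= A i j.

Definition no_zero_row (R : realType) (u v : nat) (A : 'M[R]_(u, v)) : Prop :=
  forall i, row i A != 0.

Definition no_zero_col (R : realType) (u v : nat) (A : 'M[R]_(u, v)) : Prop :=
  forall j, col j A != 0.

Definition row_normalize (R : realType) (u v : nat) (A : 'M[R]_(u, v)) :
  'M[R]_(u, v) := \matrix_(i, j) (A i j / \sum_(l < v) A i l).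

Definition col_normalize (R : realType) (u v : nat) (A : 'M[R]_(u, v)) :
  'M[R]_(u, v) := \matrix_(i, j) (A i j / \sum_(l < u) A l j).

(* Indices are shifted by one: sinkhorn_L M k is L^(k+1), and sinkhorn_T M k
   is T^(k+1). *)
Fixpoint sinkhorn_L (R : realType) (u v : nat) (M : 'M[R]_(u, v)) (k : nat) :
  'M[R]_(u, v) :=
  if k is k'.+1 then row_normalize (col_normalize (sinkhorn_L M k'))
  else row_normalize M.

Definition sinkhorn_T (R : realType) (u v : nat) (M : 'M[R]_(u, v)) (k : nat) :
  'M[R]_(u, v) := col_normalize (sinkhorn_L M k).

Definition stable_pair (R : realType) (u v : nat) (P Q : 'M[R]_(u, v)) : Prop :=
  [/\ [/\ nonneg_mx P, no_zero_row P & no_zero_col P],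
      [/\ nonneg_mx Q, no_zero_row Q & no_zero_col Q],
      col_normalize P = Q & row_normalize Q = P].

(* Main.v *)
Require Import Defs.
From mathcomp Require Import all_boot all_order all_algebra.
From mathcomp Require Import all_classical all_reals all_analysis.
From mathcomp Require Import ring lra.

(* For a row-stochastic P supported in the support of M, let D(P | A) be the
   relative entropy of P with respect to A (relent), sigma_j the column sums of
   L = L^k, rho_i the row sums of T^k, and h(A) = sum of s ln s over the column
   sums s of A (col_entropy), so that L^(k+1)_ij = L_ij / (sigma_j rho_i).
   From ln x <= x - 1 one gets
     h(L^(k+1)) <= - sum_i ln rho_i <= h(L^k),
     D(P | L^(k+1)) - D(P | L^k) <= h(P) + sum_i ln rho_i.
   The column sums of L^k stay bounded away from 0, so if P is a limit of the
   L^k along an ultrafilter, then h(P) = lim h(L^k) <= - sum_i ln rho_i, and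
   D(P | L^k) is nonincreasing. It tends to 0 along the ultrafilter, hence along
   the whole sequence, and D(P | L^k) controls the distance from L^k to P. *)

Import Order.TTheory GRing.Theory Num.Theory.
Import numFieldNormedType.Exports.

Local Open Scope classical_set_scope.
Local Open Scope ring_scope.

(** * Scalar inequalities for the logarithm *)

Lemma ln_le_subr1 {R : realType} (x : R) : 0 < x -> ln x <= x - 1.
Proof.
move=> x0; have -> : x = 1 + (x - 1) by rewrite addrC subrK.
by rewrite (le_trans (le_ln1Dx _)); lra.
Qed.

Lemma ln_div_ge {R : realType} (p q : R) : 0 < p -> 0 < q ->
  p - q <= p * ln (p / q).
Proof.
move=> p0 q0; rewrite -[p / q]invf_div lnV ?posrE ?divr_gt0//.
have := ln_le_subr1 _ (divr_gt0 q0 p0); rewrite -(ler_pM2l p0) => H.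
have E : p * (q / p - 1) = q - p by field; rewrite gt_eqF.
by rewrite E in H; rewrite mulrN; lra.
Qed.

(* Squaring the Hellinger distance: with a, b the square roots of p, q, the
   inequality ln (b / a) <= b / a - 1 gives
   p ln (p / q) - p + q >= (a - b)^2, and a + b <= 2. *)
Lemma sqr_sub_le_relent {R : realType} (p q : R) : 0 <= p <= 1 -> 0 <= q <= 1 ->
  (0 < p -> 0 < q) -> (p - q) ^+ 2 <= 4 * (p * ln (p / q) - p + q).
Proof.
move=> /andP[p0 p1] /andP[q0 q1] pq.
move: p0; rewrite le_eqVlt => /orP[/eqP <-|p0].
  by rewrite mul0r; nra.
have {}q0 := pq p0; set a := Num.sqrt p; set b := Num.sqrt q.
have a0 : 0 < a by rewrite sqrtr_gt0.
have b0 : 0 < b by rewrite sqrtr_gt0.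
have pE : p = a * a by rewrite -expr2 sqr_sqrtr// ltW.
have qE : q = b * b by rewrite -expr2 sqr_sqrtr// ltW.
have a1 : a <= 1 by rewrite -sqrtr1 ler_wsqrtr.
have b1 : b <= 1 by rewrite -sqrtr1 ler_wsqrtr.
have lnE : ln (p / q) = 2 * ln (a / b).
  by rewrite pE qE -mulf_div lnM ?posrE ?divr_gt0//; ring.
have := ln_div_ge _ _ a0 b0; rewrite lnE pE qE; move: (ln _) => t tge.
rewrite -subr_ge0.
have -> : 4 * (a * a * (2 * t) - a * a + b * b) - (a * a - b * b) ^+ 2 =
    (a - b) ^+ 2 * (4 - (a + b) ^+ 2) + 8 * a * (a * t - (a - b)) by ring.
apply: addr_ge0; first by apply: mulr_ge0; [exact: sqr_ge0|nra].
by apply: mulr_ge0; [nra|rewrite subr_ge0].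
Qed.

(** * Limits along filters on the index set *)

(** Compactness gives a cluster point [p]. If the preimage of a neighbourhood [V] of [p] were not in
    [G], that of its complement would be, and the complement would have to meet [V]. *)
Lemma ultra_cvg_segment {R : realType} {G : set_system nat} (f : nat -> R) a b :
  UltraFilter G -> (forall k, a <= f k <= b) -> exists p : R, f k @[k --> G] --> p.
Proof.
move=> GU fab; have := @segment_compact R a b.
have GP : ProperFilter (f @ G) by apply: fmap_proper_filter.
move=> /(_ (f @ G) GP) [|p [_ clp]].
  by apply: (@filterE _ G) => k; rewrite /= in_itv /= fab.
exists p => V pV; have [//|GV] := in_ultra_setVsetC (f @^-1` V) GU.
by have [x []] := clp (~` V) V GV pV.
Qed.

Lemma cvg_sumr {R : realType} {n : nat} {F : set_system nat} {FF : Filter F}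
    (f : 'I_n -> nat -> R) (l : 'I_n -> R) :
  (forall i, f i k @[k --> F] --> l i) ->
  \sum_i f i k @[k --> F] --> \sum_i l i.
Proof. by move=> fl; apply: cvg_big => //; exact: add_continuous. Qed.

(** * Row sums, column sums and entropies *)

Section Sinkhorn.
Context {R : realType} {u v : nat}.
Implicit Types A L P M : 'M[R]_(u, v).

Definition rsum A i := \sum_j A i j.
Definition csum A j := \sum_i A i j.

(** Positive column sums are included so that column normalization never divides by 0 and the
    predicate is invariant under [sk_step]. *)
Definition row_stochastic A :=
  [/\ nonneg_mx A, forall i, rsum A i = 1 & forall j, 0 < csum A j].

Definition sk_step A := row_normalize (col_normalize A).

Definition col_entropy A := \sum_j csum A j * ln (csum A j).

Definition log_rsum A := \sum_i ln (rsum (col_normalize A) i).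

(* Terms with P i j = 0 vanish, whatever A i j; terms with P i j > 0 are only
   meaningful for A i j > 0. *)
Definition relent P A := \sum_i \sum_j P i j * ln (P i j / A i j).

Lemma sum_csum A : \sum_j csum A j = \sum_i rsum A i.
Proof. by rewrite /csum exchange_big. Qed.

Lemma sum_rsum_stochastic A : row_stochastic A -> \sum_i rsum A i = u%:R.
Proof.
move=> [_ A1 _]; under eq_bigr do rewrite A1.
by rewrite sumr_const card_ord.
Qed.

Lemma nonneg_row_sum_gt0 A i : nonneg_mx A -> row i A != 0 -> 0 < rsum A i.
Proof.
move=> A0; apply: contraNT; rewrite -leNgt => Ai.
have /eqP : rsum A i = 0.
  by apply/le_anti; rewrite Ai sumr_ge0.
rewrite psumr_eq0// => /allP z; apply/eqP/rowP => j.
by rewrite !mxE; apply/eqP/z; rewrite mem_index_enum.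
Qed.

Lemma nonneg_col_sum_gt0 A j : nonneg_mx A -> col j A != 0 -> 0 < csum A j.
Proof.
move=> A0; apply: contraNT; rewrite -leNgt => Aj.
have /eqP : csum A j = 0.
  by apply/le_anti; rewrite Aj sumr_ge0.
rewrite psumr_eq0// => /allP z; apply/eqP/colP => i.
by rewrite !mxE; apply/eqP/z; rewrite mem_index_enum.
Qed.

Lemma rsum_gt0_row A i : 0 < rsum A i -> row i A != 0.
Proof.
apply: contraTneq => /rowP Ai; rewrite /rsum big1 ?ltxx// => j _.
by have := Ai j; rewrite !mxE.
Qed.

Lemma csum_gt0_col A j : 0 < csum A j -> col j A != 0.
Proof.
apply: contraTneq => /colP Aj; rewrite /csum big1 ?ltxx// => i _.
by have := Aj i; rewrite !mxE.
Qed.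

Lemma row_normalizeE A i j : row_normalize A i j = A i j / rsum A i.
Proof. by rewrite mxE. Qed.

Lemma col_normalizeE A i j : col_normalize A i j = A i j / csum A j.
Proof. by rewrite mxE. Qed.

Lemma csum_gt0_row_normalize A j : nonneg_mx A -> (forall i, 0 < rsum A i) ->
  0 < csum A j -> 0 < csum (row_normalize A) j.
Proof.
move=> A0 r0; rewrite !lt_def => /andP[c0 _].
have ge0 i : 0 <= row_normalize A i j.
  by rewrite row_normalizeE divr_ge0// ltW.
rewrite (sumr_ge0 _ (fun i _ => ge0 i)) andbT.
apply: contra_neq c0 => /eqP; rewrite psumr_eq0// => /allP z.
apply: big1 => i _; have := z i (mem_index_enum i).
by rewrite row_normalizeE mulf_eq0 invr_eq0 (gt_eqF (r0 i)) orbF => /eqP.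
Qed.

Lemma row_normalize_stochastic A : nonneg_mx A -> (forall i, 0 < rsum A i) ->
  (forall j, 0 < csum A j) -> row_stochastic (row_normalize A).
Proof.
move=> A0 r0 c0; split.
- by move=> i j; rewrite row_normalizeE divr_ge0// ltW.
- move=> i; rewrite /rsum; under eq_bigr do rewrite row_normalizeE.
  by rewrite -mulr_suml divff// gt_eqF//; exact: r0.
- by move=> j; exact: csum_gt0_row_normalize.
Qed.

(** One step divides entry (i, j) by a product [w j * z i]; this evaluates the resulting logarithmic
    terms in the three entropy estimates. *)
Lemma sum_ln_weighted P (w : 'I_v -> R) (z : 'I_u -> R) :
    (forall i, rsum P i = 1) -> (forall j, 0 < w j) -> (forall i, 0 < z i) ->
  \sum_i \sum_j P i j * ln (w j * z i) =
  \sum_j csum P j * ln (w j) + \sum_i ln (z i).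
Proof.
move=> P1 w0 z0; under eq_bigr do under eq_bigr do
  rewrite lnM ?posrE// mulrDr.
under eq_bigr do rewrite big_split /= -mulr_suml -/(rsum _ _) P1 mul1r.
rewrite big_split /= exchange_big /=; congr (_ + _).
by apply: eq_bigr => j _; rewrite mulr_suml.
Qed.

(** * Estimates for one iteration step *)

Section Step.
Variables (L : 'M[R]_(u, v)) (Ls : row_stochastic L).

Lemma col_normalize_ge0 : nonneg_mx (col_normalize L).
Proof.
by move: Ls => [L0 _ c0] i j; rewrite col_normalizeE divr_ge0// ltW.
Qed.

Lemma csum_col_normalize j : csum (col_normalize L) j = 1.
Proof.
move: Ls => [_ _ c0]; rewrite /csum; under eq_bigr do rewrite col_normalizeE.
by rewrite -mulr_suml divff// gt_eqF//; exact: c0.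
Qed.

Lemma rsum_col_normalize_gt0 i : 0 < rsum (col_normalize L) i.
Proof.
move: (Ls) => [L0 r1 c0]; apply: nonneg_row_sum_gt0 col_normalize_ge0 _.
have : row i L != 0 by apply: rsum_gt0_row; rewrite r1.
apply: contra_neq => /rowP z; apply/rowP => j; apply/eqP.
have /eqP := z j.
by rewrite !mxE -/(csum L j) mulf_eq0 invr_eq0 (gt_eqF (c0 j)) orbF.
Qed.

Lemma sk_step_stochastic : row_stochastic (sk_step L).
Proof.
apply: row_normalize_stochastic.
- exact: col_normalize_ge0.
- exact: rsum_col_normalize_gt0.
- by move=> j; rewrite csum_col_normalize.
Qed.

Lemma sk_stepE i j :
  sk_step L i j = L i j / (csum L j * rsum (col_normalize L) i).
Proof. by rewrite row_normalizeE col_normalizeE invfM mulrA. Qed.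

Lemma row_stochastic_le1 i j : 0 <= L i j <= 1.
Proof.
move: Ls => [L0 r1 _]; rewrite L0 -(r1 i) /rsum (bigD1 j)//= lerDl.
exact: sumr_ge0.
Qed.

(* Each csum (sk_step L) j is a weighted mean of the 1 / rho_i, and each row
   sum rho_i of col_normalize L is a weighted mean of the 1 / csum L j. *)
Lemma sk_step_csum_bounds m b : 0 < m -> (forall j, m <= csum L j <= b) ->
  forall j, m <= csum (sk_step L) j <= b.
Proof.
move: (Ls) => [L0 r1 c0] m0 mb j.
have b0 : 0 < b by case/andP: (mb j) => _; exact: lt_le_trans.
have rm i : rsum (col_normalize L) i <= m^-1.
  rewrite -[leRHS]mul1r -(r1 i) mulr_suml; apply: ler_sum => k _.
  by rewrite col_normalizeE ler_wpM2l// lef_pV2 ?posrE//; case/andP: (mb k).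
have rb i : b^-1 <= rsum (col_normalize L) i.
  rewrite -[leLHS]mul1r -(r1 i) mulr_suml; apply: ler_sum => k _.
  by rewrite col_normalizeE ler_wpM2l// lef_pV2 ?posrE//; case/andP: (mb k).
rewrite -[m]mul1r -[b]mul1r -(csum_col_normalize j) !mulr_suml.
apply/andP; split; apply: ler_sum => i _; rewrite row_normalizeE.
  rewrite ler_wpM2l ?col_normalize_ge0// -[leLHS]invrK.
  by rewrite lef_pV2 ?posrE ?invr_gt0 ?rsum_col_normalize_gt0.
rewrite ler_wpM2l ?col_normalize_ge0// -[leRHS]invrK.
by rewrite lef_pV2 ?posrE ?invr_gt0 ?rsum_col_normalize_gt0.
Qed.

(** With x = sigma_j rho_i, the difference of the two sides is the sum of L_ij ln x. Each term is at
    least L_ij - L_ij / x, the change of the entry in one step, and these changes sum to u - u =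
    0. *)
Lemma log_rsum_ge : - log_rsum L <= col_entropy L.
Proof.
move: (Ls) => [L0 r1 c0].
rewrite -subr_ge0 opprK -sum_ln_weighted//; last exact: rsum_col_normalize_gt0.
have : 0 <= \sum_i \sum_j (L i j - sk_step L i j).
  rewrite (eq_bigr _ (fun i _ => sumrB _ _ _ _)) sumrB.
  rewrite (sum_rsum_stochastic _ Ls) (sum_rsum_stochastic _ sk_step_stochastic).
  by rewrite subrr.
move/le_trans; apply; apply: ler_sum => i _; apply: ler_sum => j _.
have x0 : 0 < csum L j * rsum (col_normalize L) i.
  by rewrite mulr_gt0 ?rsum_col_normalize_gt0.
rewrite sk_stepE; set x := _ * rsum _ _ in x0 *.
rewrite -[X in X - _]mulr1 -mulrBr ler_wpM2l//.
have := ln_le_subr1 x^-1; rewrite invr_gt0 lnV ?posrE// => /(_ x0); lra.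
Qed.

(** Write L' for [sk_step L], T for [col_normalize L] and s_j for the column sums of L'. Then L'_ij
    ln (s_j rho_i) is at most L'_ij (s_j rho_i - 1) = T_ij s_j - L'_ij, which sums to 0 over each
    column because those of T sum to 1. *)
Lemma col_entropy_step : col_entropy (sk_step L) <= - log_rsum L.
Proof.
have [L'0 r1 c0] := sk_step_stochastic.
rewrite -subr_le0 opprK -sum_ln_weighted//; last exact: rsum_col_normalize_gt0.
have : \sum_j \sum_i (col_normalize L i j * csum (sk_step L) j
  - sk_step L i j) <= 0.
  under eq_bigr do rewrite sumrB -mulr_suml -/(csum _ _) csum_col_normalize
    mul1r -/(csum _ _) subrr.
  by rewrite big1.
apply: le_trans; rewrite exchange_big /=.
apply: ler_sum => j _; apply: ler_sum => i _.
have t0 := rsum_col_normalize_gt0 i.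
have -> : col_normalize L i j = sk_step L i j * rsum (col_normalize L) i.
  by rewrite row_normalizeE divfK// gt_eqF.
rewrite -mulrA -[X in _ - X]mulr1 -mulrBr ler_wpM2l//.
by rewrite [X in _ <= X - 1]mulrC; apply: ln_le_subr1; rewrite mulr_gt0.
Qed.

(** The change is computed exactly; the bound is then Gibbs' inequality between the column sums of
    [P] and of [L], which have the same total u. *)
Lemma relent_step P : row_stochastic P -> (forall i j, 0 < P i j -> 0 < L i j) ->
  relent P (sk_step L) - relent P L <= col_entropy P + log_rsum L.
Proof.
move: (Ls) => [L0 r1 c0] Ps PL; move: (Ps) => [P0 P1 Pc].
have -> : relent P (sk_step L) - relent P L =
    \sum_j csum P j * ln (csum L j) + log_rsum L.
  rewrite -sum_ln_weighted//; last exact: rsum_col_normalize_gt0.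
  rewrite /relent -sumrB; apply: eq_bigr => i _.
  rewrite -sumrB; apply: eq_bigr => j _; rewrite -mulrBr.
  have [Pij|] := ltP 0 (P i j); last first.
    by move=> Pij; rewrite (@le_anti _ _ (P i j) 0) ?Pij ?P0// !mul0r.
  have t0 := rsum_col_normalize_gt0 i; have Lij := PL _ _ Pij.
  rewrite sk_stepE !ln_div ?posrE ?divr_gt0 ?mulr_gt0//; congr (_ * _); ring.
rewrite lerD2r -subr_ge0 -sumrB.
have : 0 <= \sum_j (csum P j - csum L j).
  by rewrite sumrB !sum_csum !sum_rsum_stochastic// subrr.
move/le_trans; apply; apply: ler_sum => j _.
by rewrite -mulrBr -ln_div ?posrE// ln_div_ge.
Qed.

End Step.

(** * From relative entropy to entrywise distance *)

(** Both matrices have total u, so adding - P + L to each term leaves the sum unchanged and makes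
    every term nonnegative; one term is then at most the whole sum. *)
Lemma sqr_sub_le_relent_mx P L i j : row_stochastic P -> row_stochastic L ->
  (forall i j, 0 < P i j -> 0 < L i j) ->
  (P i j - L i j) ^+ 2 <= 4 * relent P L.
Proof.
move=> Ps Ls PL.
pose d i j := P i j * ln (P i j / L i j) - P i j + L i j.
have dge k l : (P k l - L k l) ^+ 2 <= 4 * d k l.
  by apply: sqr_sub_le_relent; [exact: row_stochastic_le1..|exact: PL].
have d0 k l : 0 <= d k l.
  by rewrite -(pmulr_rge0 _ (ltr0n R 4)) (le_trans _ (dge k l)) ?sqr_ge0.
have -> : relent P L = \sum_k \sum_l d k l.
  under [RHS]eq_bigr do rewrite big_split sumrB /=.
  rewrite big_split sumrB /= (sum_rsum_stochastic _ Ps).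
  by rewrite (sum_rsum_stochastic _ Ls) subrK.
apply: le_trans (dge i j) _; rewrite ler_pM2l//.
rewrite (bigD1 i)//= (bigD1 j)//= -addrA lerDl addr_ge0//.
  exact: sumr_ge0.
by apply: sumr_ge0 => k _; exact: sumr_ge0.
Qed.

Lemma relentxx P : relent P P = 0.
Proof.
apply: big1 => i _; apply: big1 => j _.
have [->|p0] := eqVneq (P i j) 0; first by rewrite mul0r.
by rewrite divff// ln1 mulr0.
Qed.

(** * Continuity of sums, normalizations and entropies *)

Section Limits.
Context {F : set_system nat} {FF : Filter F}.
Variables (A_ : nat -> 'M[R]_(u, v)) (A : 'M[R]_(u, v)).
Hypothesis cA : forall i j, A_ k i j @[k --> F] --> A i j.

Lemma cvg_mx : A_ k @[k --> F] --> A.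
Proof.
move=> V [W /= nW sW].
have : \forall k \near F, forall i, forall j, W i j (A_ k i j).
  apply: (@filter_forall _ _ (fun i => [set k | forall j, W i j (A_ k i j)])).
  move=> i; apply: (@filter_forall _ _ (fun j => [set k | W i j (A_ k i j)])).
  by move=> j; exact: cA (nW i j).
by apply: filterS => k Wk; exact: sW.
Qed.

Lemma cvg_csum j : csum (A_ k) j @[k --> F] --> csum A j.
Proof. exact: cvg_sumr. Qed.

Lemma cvg_rsum i : rsum (A_ k) i @[k --> F] --> rsum A i.
Proof. exact: cvg_sumr. Qed.

Lemma cvg_col_normalize i j : 0 < csum A j ->
  col_normalize (A_ k) i j @[k --> F] --> col_normalize A i j.
Proof.
move=> c0; rewrite col_normalizeE; under eq_cvg do rewrite col_normalizeE.
by apply: cvgM; [exact: cA|apply: cvgV; [rewrite gt_eqF|exact: cvg_csum]].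
Qed.

Lemma cvg_row_normalize i j : 0 < rsum A i ->
  row_normalize (A_ k) i j @[k --> F] --> row_normalize A i j.
Proof.
move=> r0; rewrite row_normalizeE; under eq_cvg do rewrite row_normalizeE.
by apply: cvgM; [exact: cA|apply: cvgV; [rewrite gt_eqF|exact: cvg_rsum]].
Qed.

Lemma cvg_col_entropy : (forall j, 0 < csum A j) ->
  col_entropy (A_ k) @[k --> F] --> col_entropy A.
Proof.
move=> c0; apply: cvg_sumr => j; apply: cvgM; first exact: cvg_csum.
by apply: continuous_cvg; [exact: continuous_ln|exact: cvg_csum].
Qed.

Lemma cvg_relent_self : nonneg_mx A -> relent A (A_ k) @[k --> F] --> 0.
Proof.
move=> A0; rewrite -(relentxx A); apply: cvg_sumr => i; apply: cvg_sumr => j.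
have := A0 i j; rewrite le_eqVlt => /orP[/eqP <-|a0].
  (* Where the limit entry is 0 the term vanishes identically, so continuity of [ln] is needed only
     at positive points. *)
  by under eq_cvg do rewrite mul0r; rewrite mul0r; exact: cvg_cst.
apply: cvgM; first exact: cvg_cst.
apply: continuous_cvg; first by apply: continuous_ln; rewrite divff// gt_eqF.
by apply: cvgM; [exact: cvg_cst|apply: cvgV; [rewrite gt_eqF|exact: cA]].
Qed.

End Limits.

(** * Monotone quantities and convergence of the iteration *)

Section Iteration.
Variable M : 'M[R]_(u, v).
Hypothesis M_ge0 : nonneg_mx M.
Hypothesis M_rows : no_zero_row M.
Hypothesis M_cols : no_zero_col M.

Let L k := sinkhorn_L M k.

Lemma sinkhorn_LS k : L k.+1 = sk_step (L k).
Proof. by []. Qed.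

Lemma sinkhorn_L_stochastic k : row_stochastic (L k).
Proof.
elim: k => [|k IH]; last exact: sk_step_stochastic.
apply: row_normalize_stochastic => // [i|j].
  exact: nonneg_row_sum_gt0.
exact: nonneg_col_sum_gt0.
Qed.

Lemma sinkhorn_L_gt0 k i j : (0 < L k i j) = (0 < M i j).
Proof.
elim: k => [|k IH].
  by rewrite row_normalizeE pmulr_lgt0// invr_gt0 nonneg_row_sum_gt0.
have Ls := sinkhorn_L_stochastic k; have [_ _ c0] := Ls.
by rewrite sinkhorn_LS sk_stepE// pmulr_lgt0// invr_gt0 mulr_gt0//
  rsum_col_normalize_gt0.
Qed.

Lemma sinkhorn_csum_lower_bound :
  exists2 m, 0 < m & forall k j, m <= csum (L k) j.
Proof.
have [_ _ c0] := sinkhorn_L_stochastic 0.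
(* [s] exceeds every reciprocal of an initial column sum; the summand 1 keeps it positive even for v
   = 0. *)
pose s := 1 + \sum_j (csum (L 0) j)^-1.
have s0 : 0 < s.
  by rewrite ltr_pwDl// sumr_ge0// => j _; rewrite invr_ge0 ltW.
exists s^-1; first by rewrite invr_gt0.
have H0 j : s^-1 <= csum (L 0) j <= \sum_j csum (L 0) j.
  apply/andP; split.
    rewrite -[leRHS]invrK lef_pV2 ?posrE ?invr_gt0// /s (bigD1 j)//=.
    rewrite addrCA lerDl addr_ge0// sumr_ge0// => l _.
    by rewrite invr_ge0 ltW.
  by rewrite (bigD1 j)//= lerDl sumr_ge0// => l _; exact: ltW.
suff H k j : s^-1 <= csum (L k) j <= \sum_j csum (L 0) j.
  by move=> k j; case/andP: (H k j).
elim: k j => // k IH j; apply: sk_step_csum_bounds => //.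
  exact: sinkhorn_L_stochastic.
by rewrite invr_gt0.
Qed.

Lemma col_entropy_nonincreasing : nonincreasing_seq (fun k => col_entropy (L k)).
Proof.
apply/nonincreasing_seqP => k; rewrite sinkhorn_LS.
have Ls := sinkhorn_L_stochastic k.
exact: le_trans (col_entropy_step _ Ls) (log_rsum_ge _ Ls).
Qed.

(** Since h(L^k) decreases, its limit h(P) lies below h(L^(k+1)), hence below - sum_i ln rho_i, and
    the bound of [relent_step] is nonpositive. *)
Lemma relent_nonincreasing P (G : set_system nat) : ProperFilter G -> \oo `<=` G ->
    (forall i j, L k i j @[k --> G] --> P i j) -> row_stochastic P ->
    (forall i j, 0 < P i j -> 0 < M i j) ->
  nonincreasing_seq (fun k => relent P (L k)).
Proof.
move=> GP ooG LP Ps PM; apply/nonincreasing_seqP => k; rewrite sinkhorn_LS.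
have Ls := sinkhorn_L_stochastic k; have [_ _ Pc] := Ps.
rewrite -subr_le0; apply: le_trans (relent_step _ Ls _ Ps _) _.
  by move=> i j /PM; rewrite sinkhorn_L_gt0.
suff : col_entropy P <= col_entropy (L k.+1).
  by have := col_entropy_step _ Ls; rewrite sinkhorn_LS; lra.
apply: (cvgr_to_le (cvg_col_entropy _ _ LP Pc)).
apply: ooG; exists k.+1 => // l /= kl.
exact: col_entropy_nonincreasing.
Qed.

Lemma sinkhorn_L_cvg : exists2 P, row_stochastic P &
  forall i j, L k i j @[k --> \oo] --> P i j.
Proof.
have [G [GU ooG]] := ultraFilterLemma (_ : ProperFilter \oo).
have GP : ProperFilter G by exact: ultra_proper.
have Ls := sinkhorn_L_stochastic.
have /choice[p pP] : forall ij : 'I_u * 'I_v, exists p : R,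
    L k ij.1 ij.2 @[k --> G] --> p.
  move=> [i j]; apply: (ultra_cvg_segment (fun k => L k i j) 0 1) => k.
  exact: row_stochastic_le1.
pose P : 'M[R]_(u, v) := \matrix_(i, j) p (i, j).
have LP i j : L k i j @[k --> G] --> P i j by rewrite mxE; exact: (pP (i, j)).
(* A lower bound uniform in [k] passes to the limit and keeps the column sums of [P] positive. *)
have [m m0 mL] := sinkhorn_csum_lower_bound.
have P0 : nonneg_mx P.
  move=> i j; apply: (cvgr_to_ge (LP i j)).
  by apply: (@filterE _ G) => k; have [] := Ls k.
have Ps : row_stochastic P.
  split=> // [i|j].
    have : rsum (L k) i @[k --> G] --> rsum P i by exact: cvg_rsum.
    have -> : (fun k => rsum (L k) i) = cst 1.
      by apply/funext => k; have [] := Ls k.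
    by move/(cvg_unique (@norm_hausdorff _ R)); apply; exact: cvg_cst.
  apply: (lt_le_trans m0); apply: (cvgr_to_ge (cvg_csum _ _ LP j)).
  by apply: (@filterE _ G) => k.
have PM i j : 0 < P i j -> 0 < M i j.
  apply: contraTT; rewrite -!leNgt => Mij; apply: (cvgr_to_le (LP i j)).
  by apply: (@filterE _ G) => k; rewrite leNgt sinkhorn_L_gt0 -leNgt.
have PL k i j : 0 < P i j -> 0 < L k i j by rewrite sinkhorn_L_gt0; exact: PM.
have Dle := relent_nonincreasing _ _ GP ooG LP Ps PM.
exists P => // i j.
have D0 : relent P (L k) @[k --> G] --> 0 by exact: cvg_relent_self.
apply/cvgrPdist_lt => e e0.
have e4 : 0 < e ^+ 2 / 4 by rewrite divr_gt0// exprn_gt0.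
(* One index with small relative entropy suffices: monotonicity extends the bound to all later
   ones. *)
have [n Dn] : exists n, relent P (L n) < e ^+ 2 / 4.
  exact: filter_ex (cvgr_lt _ D0 _ e4).
exists n => // k /= nk.
rewrite -(ltr_pXn2r (ltn0Sn 1)) ?nnegrE ?(ltW e0)//.
rewrite real_normK ?num_real//.
apply: le_lt_trans (sqr_sub_le_relent_mx _ _ i j Ps (Ls k) (PL k)) _.
by have := Dle _ _ nk => /= ?; lra.
Qed.

End Iteration.

End Sinkhorn.

(** * Stability of the limit pair *)

Theorem theorem12 (R : realType) (u v : nat) (M : 'M[R]_(u, v))
    (M_ge0 : nonneg_mx M) (M_rows : no_zero_row M) (M_cols : no_zero_col M) :
  exists L T : 'M[R]_(u, v),
    [/\ sinkhorn_L M k @[k --> \oo] --> L,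
        sinkhorn_T M k @[k --> \oo] --> T
      & stable_pair L T].
Proof.
have [P Ps LP] := sinkhorn_L_cvg M M_ge0 M_rows M_cols.
have [P0 P1 Pc] := Ps.
have TP i j : sinkhorn_T M k i j @[k --> \oo] --> col_normalize P i j.
  exact: cvg_col_normalize.
exists P, (col_normalize P); split; [exact: cvg_mx..|split=> //].
- split=> // [i|j]; first by apply: rsum_gt0_row; rewrite P1.
  exact: csum_gt0_col.
- split=> [|i|j]; first exact: col_normalize_ge0.
    by apply: rsum_gt0_row; exact: rsum_col_normalize_gt0.
  by apply: csum_gt0_col; rewrite csum_col_normalize.
- apply/matrixP => i j.
  have TL : row_normalize (sinkhorn_T M k) i j @[k --> \oo] -->
      row_normalize (col_normalize P) i j.
    by apply: cvg_row_normalize => //; exact: rsum_col_normalize_gt0.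
  apply: (cvg_unique (@norm_hausdorff _ R) TL).
  (* The row normalization of T^k is L^(k+1), so the shifted sequence has the same limit [P]. *)
  by have := LP i j; rewrite -(cvg_shiftS (fun k => sinkhorn_L M k i j)).
Qed.
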